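(* Let $T_+$ be the biperiodic ($2$-periodic) and $5$-banded Toeplitz operator acting on $\ell^2(\mathbb{N}_0)$ whose matrix $(\langle T_+e_k,e_j\rangle)_{j,k\in\mathbb{N}_0}$ has entries, for all $j,k\in\mathbb{N}_0$, \[ \langle T_+e_k,e_j\rangle=\begin{cases} -1 & \text{if } k=j+1 \text{ and } j \text{ is even},\\ 2 & \text{if } k=j+1 \text{ and } j \text{ is odd},\\ 1 & \text{if } k=j+2,\\ 0 & \text{otherwise,}\end{cases} \] that is, \[ T_+=\begin{pmatrix} 0 & -1 & 1 & 0 & 0 & 0 & \cdots \\ 0 & 0 & 2 & 1 & 0 & 0 & \cdots \\ 0 & 0 & 0 & -1 & 1 & 0 & \cdots \\ 0 & 0 & 0 & 0 & 2 & 1 & \cdots \\ \vdots & & & & & \ddots & \ddots \end{pmatrix}. \] Then for every $k\in\mathbb{N}$ there is no $k\times k$ complex matrix $B$ such that \[ \overline{W(T_+)} = W(B). \]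
   Context: $\mathbb{N}$ denotes the positive integers and $\mathbb{N}_0$ the nonnegative integers; $(e_k)_{k\in\mathbb{N}_0}$ is the canonical orthonormal basis of $\ell^2(\mathbb{N}_0)$. For a bounded operator (or matrix) $A$ on a complex Hilbert space, $W(A)=\{\langle Ax,x\rangle : \|x\|=1\}$ is its numerical range; the bar denotes closure in $\mathbb{C}$. *)

(* Defs.v *)
From HB Require Import structures.
From mathcomp Require Import all_boot all_order all_algebra.
From mathcomp Require Import complex ring.
From mathcomp Require Import all_classical all_reals.
From mathcomp Require Import topology normedtype sequences.

Set Implicit Arguments.
Unset Strict Implicit.
Unset Printing Implicit Defensive.

Import Order.TTheory GRing.Theory Num.Theory.
Import numFieldNormedType.Exports.

Local Open Scope classical_set_scope.
Local Open Scope ring_scope.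

(* R[i] packed as a numClosedFieldType: topological structures are inferred
   for the latter (the metric topology of the modulus) but not for the bare
   type R[i]. *)
Definition Cplx (R : realType) : numClosedFieldType := R[i].

Section NumericalRange.
Variables (C : numClosedFieldType) (V : Type).

(* The Hilbert space is the subset H of V with inner product dot, linear in
   its first argument; H is a proper subset when V is the type of all complex
   sequences and H is l^2. *)
Definition hnorm (dot : V -> V -> C) (x : V) : C := sqrtC (dot x x).

Definition numrange (H : set V) (dot : V -> V -> C) (A : V -> V) : set C :=
  [set dot (A x) x | x in [set x | H x /\ hnorm dot x = 1]].

End NumericalRange.

(* dotmx is the standard inner product on row vectors, hence the transposes. *)
Definition mx_numrange (C : numClosedFieldType) (k : nat) (B : 'M[C]_k) :
    set C :=
  numrange [set: 'cV[C]_k] (fun x y => dotmx x^T y^T) (mulmx B).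

Section SequenceSpace.
Variable C : numClosedFieldType.
Implicit Types x y : nat -> C.

Definition ell2 : set (nat -> C) :=
  [set x : nat -> C | cvgn (series (fun k => `|x k| ^+ 2) : nat -> C)].

(* limn returns a default value on divergent series; this plays no role for
   x and y in ell2. *)
Definition ell2_dot x y : C :=
  limn (series (fun k => x k * (y k)^*) : nat -> C).

Definition ell2_basis (k : nat) : nat -> C := fun j => (j == k)%:R.

(* The operator with matrix a, where a j k is the entry in row j, column k. *)
Definition ell2_mxop (a : nat -> nat -> C) x : nat -> C :=
  fun j => limn (series (fun k => a j k * x k) : nat -> C).

Definition Tplus_entry (j k : nat) : C :=
  if k == j.+1 then (if odd j then 2 else -1)
  else if k == j.+2 then 1 else 0.

Definition Tplus : (nat -> C) -> (nat -> C) := ell2_mxop Tplus_entry.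

Lemma limn_series_finsupp (u : nat -> C) (N : nat) :
  (forall k, (N <= k)%N -> u k = 0) ->
  limn (series u : nat -> C) = \sum_(0 <= k < N) u k.
Proof.
move=> u0; apply: (@cvg_lim _ (@norm_hausdorff C C)); apply: cvg_near_cst.
exists N => // n /= leNn; rewrite /series /= (big_cat_nat (leq0n N) leNn) //=.
rewrite [X in _ + X](_ : _ = 0) ?addr0 // big_nat_cond big1 // => i.
by rewrite andbT => /andP[Ni _]; exact: u0.
Qed.

Lemma TplusE x j : Tplus x j = (if odd j then 2 else -1) * x j.+1 + x j.+2.
Proof.
rewrite /Tplus /ell2_mxop (@limn_series_finsupp _ j.+3) => [|k lt_j_k].
  rewrite 2?big_nat_recr //= big_nat_cond big1 => [|i].
    by rewrite /Tplus_entry !eqxx eqSS gtn_eqF // add0r mul1r.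
  rewrite andbT => /andP[_ lt_i]; rewrite /Tplus_entry.
  by rewrite !ltn_eqF ?mul0r // (ltn_trans lt_i).
by rewrite /Tplus_entry !gtn_eqF ?mul0r // (ltn_trans _ lt_j_k).
Qed.

Lemma Tplus_linear (a : C) x y j :
  Tplus (fun k => a * x k + y k) j = a * Tplus x j + Tplus y j.
Proof. by rewrite !TplusE; ring. Qed.

Lemma Tplus_matrix j k :
  ell2_dot (Tplus (ell2_basis k)) (ell2_basis j) = Tplus_entry j k.
Proof.
rewrite /ell2_dot (@limn_series_finsupp _ j.+1) => [|i lt_j_i]; last first.
  by rewrite /ell2_basis gtn_eqF // conjC0 mulr0.
rewrite big_nat_recr //= big_nat_cond big1 => [|i]; last first.
  by rewrite andbT => /andP[_ lt_i]; rewrite /ell2_basis ltn_eqF // conjC0 mulr0.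
rewrite add0r /ell2_basis eqxx conjC1 mulr1 TplusE /Tplus_entry eq_sym.
rewrite (eq_sym j.+2); case: eqP => [->|_]; last first.
  by rewrite mulr0 add0r; case: eqP.
by rewrite mulr1 ltn_eqF // addr0.
Qed.

End SequenceSpace.

Section Boundedness.
Variable R : realType.
Local Notation C := (Cplx R).

Lemma normc_ge_Im (z : R[i]) : (`|complex.Im z|%:C)%C <= `|z|.
Proof.
by case: z => a b; rewrite normc_def /= lecR -sqrtr_sqr ler_wsqrtr // lerDr sqr_ge0.
Qed.

Lemma Re_cvg (u : nat -> C) (l : C) :
  u @ \oo --> l -> (fun n => complex.Re (u n)) @ \oo --> complex.Re l.
Proof.
move=> /cvgrPdist_lt ul; apply/cvgrPdist_lt => e e0.
have e0' : (0 : C) < (e%:C)%C by rewrite ltcR.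
apply: filterS (ul _ e0') => n lt_e; rewrite -ltcR; apply: le_lt_trans lt_e.
rewrite (_ : complex.Re l - _ = complex.Re (l - u n)); first exact: normc_ge_Re.
by case: (l) (u n) => [? ?] [? ?].
Qed.

Lemma Im_cvg (u : nat -> C) (l : C) :
  u @ \oo --> l -> (fun n => complex.Im (u n)) @ \oo --> complex.Im l.
Proof.
move=> /cvgrPdist_lt ul; apply/cvgrPdist_lt => e e0.
have e0' : (0 : C) < (e%:C)%C by rewrite ltcR.
apply: filterS (ul _ e0') => n lt_e; rewrite -ltcR; apply: le_lt_trans lt_e.
rewrite (_ : complex.Im l - _ = complex.Im (l - u n)); first exact: normc_ge_Im.
by case: (l) (u n) => [? ?] [? ?].
Qed.

Lemma real_complex_cvg (v : nat -> R) (l : R) :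
  v @ \oo --> l -> (fun n => (v n)%:C%C : C) @ \oo --> (l%:C%C : C).
Proof.
move=> /cvgrPdist_lt vl; apply/cvgrPdist_lt => -[e f].
rewrite ltcE /= => /andP[/eqP-> e0].
apply: filterS (vl _ e0) => n vn.
by rewrite -rmorphB /= normc_def /= expr0n addr0 sqrtr_sqr ltcR.
Qed.

Lemma nneg_series_bounded (u : nat -> C) (M : C) :
  (forall k, 0 <= u k) -> (forall n, series u n <= M) ->
  cvgn (series u : nat -> C) /\ limn (series u : nat -> C) <= M.
Proof.
move=> u0 uM.
have nd m n : (m <= n)%N -> series u m <= series u n.
  move=> le_mn; rewrite /series /= (big_cat_nat (leq0n m) le_mn) //= lerDl.
  exact: sumr_ge0.
have E n : series u n = (complex.Re (series u n))%:C%C.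
  have : 0 <= series u n by exact: sumr_ge0.
  by case: (series u n) => a b; rewrite lecE /= => /andP[/eqP-> _].
pose v n := complex.Re (series u n).
have vM n : v n <= complex.Re M.
  by have := uM n; rewrite lecE => /andP[].
have cv : cvgn v.
  apply: nondecreasing_is_cvgn.
    by move=> m n le_mn; have := nd _ _ le_mn; rewrite lecE => /andP[].
  by exists (complex.Re M) => _ [n _ <-].
have cu : (series u : nat -> C) @ \oo --> ((limn v)%:C%C : C).
  rewrite (_ : (series u : nat -> C) = fun n => (v n)%:C%C); last first.
    by apply: funext => n; rewrite /v -E.
  exact: real_complex_cvg.
split; first by apply/cvg_ex; exists ((limn v)%:C%C).
rewrite (cvg_lim (@norm_hausdorff C C) cu).
have := uM 0%N; rewrite E !lecE /= => /andP[-> _] /=.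
by apply: limr_le => //; apply: nearW.
Qed.

Lemma nneg_series_le (u : nat -> C) n :
  (forall k, 0 <= u k) -> cvgn (series u : nat -> C) ->
  series u n <= limn (series u : nat -> C).
Proof.
move=> u0 cu.
have nd m : (n <= m)%N -> series u n <= series u m.
  move=> le_nm; rewrite /series /= (big_cat_nat (leq0n n) le_nm) //= lerDl.
  exact: sumr_ge0.
rewrite lecE; apply/andP; split.
  apply/eqP; apply: (cvg_unique (@norm_hausdorff R R) (Im_cvg cu)).
  apply: cvg_near_cst; exists n => // m /= /nd.
  by rewrite lecE => /andP[/eqP].
have cR := Re_cvg cu.
rewrite -(cvg_lim (@norm_hausdorff R R) cR).
apply: limr_ge; first by apply/cvg_ex; eexists; exact: cR.
by exists n => // m /= /nd; rewrite lecE => /andP[].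
Qed.

Lemma Tplus_bounded (x : nat -> C) : ell2 x ->
  ell2 (Tplus x) /\
  hnorm (@ell2_dot C) (Tplus x) <= sqrtC 10 * hnorm (@ell2_dot C) x.
Proof.
move=> cx; set u := fun k => `|x k| ^+ 2 in cx.
have u0 k : 0 <= u k by rewrite exprn_ge0.
have dotE y : ell2_dot y y = limn (series (fun k => `|y k| ^+ 2) : nat -> C).
  by rewrite /ell2_dot; congr (limn (series _ : nat -> C)); apply: funext => k;
    rewrite normCK.
have le2 (a b : C) : `|a + b| ^+ 2 <= 2 * `|a| ^+ 2 + 2 * `|b| ^+ 2.
  apply: (@le_trans _ _ ((`|a| + `|b|) ^+ 2)).
    by rewrite lerXn2r ?nnegrE ?addr_ge0 // ler_normD.
  rewrite -subr_ge0 (_ : _ - _ = (`|a| - `|b|) ^+ 2); last by ring.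
  by rewrite real_exprn_even_ge0 // rpredB // normr_real.
have leT j : `|Tplus x j| ^+ 2 <= 8 * u j.+1 + 2 * u j.+2.
  rewrite TplusE; apply: le_trans (le2 _ _) _; rewrite lerD2r normrM exprMn mulrA.
  apply: (ler_wpM2r (u0 j.+1)); case: (odd j).
    by rewrite normr_nat -!natrX -natrM.
  by rewrite normrN1 expr1n mulr1 ler_nat.
have [||cT leM] := @nneg_series_bounded (fun k => `|Tplus x k| ^+ 2)
  (10 * limn (series u : nat -> C)).
- by move=> k; rewrite exprn_ge0.
- move=> n.
  have shift m : \sum_(0 <= k < n) u (k + m)%N <= limn (series u : nat -> C).
    apply: le_trans (nneg_series_le (n + m) u0 cx).
    rewrite /series /= (@big_cat_nat _ _ _ m 0 (n + m)) ?leq_addl //=.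
    by rewrite -[X in \sum_(X <= _ < n + m) _]add0n big_addn addnK lerDr sumr_ge0.
  apply: (@le_trans _ _ (\sum_(0 <= k < n) (8 * u (k + 1)%N + 2 * u (k + 2)%N))).
    by apply: ler_sum => k _; rewrite addn1 addn2.
  pose L : C := limn (series u : nat -> C).
  rewrite big_split /= -!mulr_sumr (_ : 10 * _ = 8 * L + 2 * L);
    last by rewrite -mulrDl -natrD.
  by apply: lerD; (apply: ler_wpM2l; first by rewrite ler0n); exact: shift.
split=> //; rewrite /hnorm !dotE -sqrtCM ?nnegrE ?ler0n //; last first.
  by apply: le_trans (nneg_series_le 0 u0 cx); rewrite /series /= big_geq.
have T0 : 0 <= limn (series (fun k => `|Tplus x k| ^+ 2) : nat -> C).
  apply: le_trans (nneg_series_le 0 _ cT); first by rewrite /series /= big_geq.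
  by move=> k; rewrite exprn_ge0.
by rewrite ler_sqrtC // nnegrE // (le_trans T0 leM).
Qed.

End Boundedness.

(* Main.v *)
Require Import Defs.
From mathcomp Require Import all_boot all_order all_algebra.
From mathcomp Require Import complex ring lra.
From mathcomp Require Import all_classical all_reals.
From mathcomp Require Import topology normedtype sequences.

Import Order.TTheory GRing.Theory Num.Theory.
Import numFieldNormedType.Exports.
Local Open Scope classical_set_scope.
Local Open Scope ring_scope.

(* The closure of W(T) meets the line Re = 3/2 only at 3/2, and its boundary is
   flat to fourth order there, whereas the numerical range of a matrix lying in
   Re <= 3/2 and meeting that line in the single point 3/2 satisfies
   Im w <= M sqrt (3/2 - Re w).
   Flatness: for |z| = 1 the Bloch waves x_{2m} = z^m, x_{2m+1} = z^{m+2},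
   truncated, give the points z + conj z - z^2/2, with real part
   3/2 - (1 - Re z)^2 and imaginary part - Im z Re z.
   Contact at 3/2 only: 3/2 |x|^2 - Re <Tx, x> is a sum of squares of
   residuals. If the residuals vanish then so do the second differences
   x_{k+4} - 2 x_{k+2} + x_k, and summation by parts bounds the first
   differences, hence Im <Tx, x>, by e |x|^2 + K(e) (3/2 |x|^2 - Re <Tx, x>)
   for every e > 0. *)

(** * Real quadratic forms *)

Section RealForms.
Variable R : realFieldType.
Implicit Types (p q g : nat -> R) (k n : nat).

(** The first superdiagonal of [Tplus], with real values. *)
Definition coef k : R := if odd k then 2 else -1.

(* The coefficients come from a Fejer-Riesz factorization of [3 / 2 - Re T]. *)
Definition resid p k : R :=
  if odd k then p k - p k.+1 / 2 - p k.+2 / 2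
  else p k / 2 + p k.+1 / 2 - p k.+2.

Definition step2 p k : R := p k.+2 - p k.

Lemma sum_shift_nneg g n : (forall k, 0 <= g k) -> g n = 0 ->
  \sum_(0 <= k < n) g k.+1 <= \sum_(0 <= k < n) g k.
Proof.
move=> g_ge0 gn0; rewrite -(big_add1 _ _ 0 n.+1 xpredT g).
have -> : \sum_(0 <= k < n) g k = \sum_(0 <= k < n.+1) g k.
  by rewrite big_nat_recr //= gn0 addr0.
by rewrite [leRHS]big_nat_recl // big_add1 lerDr.
Qed.

Section FiniteSupport.
Variables (p : nat -> R) (n : nat).
Hypotheses (p0 : p 0%N = 0) (p1 : p 1%N = 0).
Hypothesis p_supp : forall k, (n <= k)%N -> p k = 0.

Let pn : p n = 0. Proof. by rewrite p_supp. Qed.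
Let pn1 : p n.+1 = 0. Proof. by rewrite p_supp. Qed.

Let resid_supp k : (n <= k)%N -> resid p k = 0.
Proof.
move=> nk; have nk1 := leqW nk; have nk2 := leqW nk1.
by rewrite /resid !p_supp //; case: ifP => _; ring.
Qed.

(** The summands of the two sides differ by [psi k.+1 - psi k], with [psi] quadratic in two
    consecutive values. The sum telescopes to 0 because [p] vanishes at 0, 1, [n] and [n.+1]. *)
Lemma sum_resid_sq :
  \sum_(0 <= k < n) resid p k ^+ 2 =
  3 / 2 * \sum_(0 <= k < n) p k ^+ 2 -
  \sum_(0 <= k < n) (coef k * p k.+1 + p k.+2) * p k.
Proof.
pose psi k := if odd k then p k ^+ 2 / 2 + p k.+1 ^+ 2 - p k * p k.+1
  else 5 / 4 * p k ^+ 2 + p k.+1 ^+ 2 / 4 + p k * p k.+1 / 2.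
have S0 : \sum_(0 <= k < n) (psi k.+1 - psi k) = 0.
  by rewrite telescope_sumr // /psi p0 p1 pn pn1; case: ifP => _ /=; field.
rewrite mulr_sumr -sumrB -[RHS]addr0 -[X in _ = _ + X]S0 -big_split /=.
apply: eq_bigr => k _.
by rewrite /resid /psi /coef /=; case: (odd k) => /=; field.
Qed.

(** Summation by parts replaces one factor [step2 p k] by the second difference [E], a combination
    of residuals. Young's inequality with weight [eta] then separates [E] from [p]. *)
Lemma sum_step2_sq (eta : R) : 0 < eta ->
  \sum_(0 <= k < n) step2 p k ^+ 2 <=
  eta * \sum_(0 <= k < n) p k ^+ 2 +
  5 / eta * \sum_(0 <= k < n) resid p k ^+ 2.
Proof.
move=> eta0.
pose th k := step2 p k * p k + step2 p k.+1 * p k.+1.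
have S0 : \sum_(0 <= k < n) (th k.+1 - th k) = 0.
  by rewrite telescope_sumr // /th p0 p1 pn pn1; ring.
pose g k := p k ^+ 2; pose r k := resid p k ^+ 2.
have g0 k : 0 <= g k by exact: sqr_ge0.
have r0 k : 0 <= r k by exact: sqr_ge0.
have gS1 : \sum_(0 <= k < n) g k.+1 <= \sum_(0 <= k < n) g k.
  by apply: sum_shift_nneg => //; rewrite /g pn expr0n.
have gS2 : \sum_(0 <= k < n) g k.+2 <= \sum_(0 <= k < n) g k.+1.
  by apply: (@sum_shift_nneg (fun k => g k.+1)) => //; rewrite /g pn1 expr0n.
have rS1 : \sum_(0 <= k < n) r k.+1 <= \sum_(0 <= k < n) r k.
  by apply: sum_shift_nneg => //; rewrite /r resid_supp // expr0n.
have rS2 : \sum_(0 <= k < n) r k.+2 <= \sum_(0 <= k < n) r k.+1.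
  apply: (@sum_shift_nneg (fun k => r k.+1)) => //.
  by rewrite /r resid_supp // expr0n.
have loc k : step2 p k ^+ 2 <= th k.+1 - th k + eta * g k.+2 +
    (3 / 2 * (r k + r k.+1 + r k.+2)) / eta.
  (* The coefficients of the residuals are 1, 1, -2 or 2, -1, -1, so Cauchy-Schwarz gives the
     constant 1 + 1 + 4 = 6. *)
  have E2 : (step2 p k.+2 - step2 p k) ^+ 2 <= 6 * (r k + r k.+1 + r k.+2).
    rewrite (_ : step2 p k.+2 - _ =
      if odd k then resid p k + resid p k.+1 - 2 * resid p k.+2
      else 2 * resid p k - resid p k.+1 - resid p k.+2); last first.
      by rewrite /step2 /resid /=; case: (odd k) => /=; field.
    rewrite /r; move: (resid p k) (resid p k.+1) (resid p k.+2) => a b c.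
    case: ifP => _; rewrite -subr_ge0.
      have := sqr_ge0 (a - b); have := sqr_ge0 (2 * a + c).
      by have := sqr_ge0 (2 * b + c); lra.
    have := sqr_ge0 (a + 2 * b); have := sqr_ge0 (a + 2 * c).
    by have := sqr_ge0 (b - c); lra.
  set E := step2 p k.+2 - step2 p k in E2.
  have -> : step2 p k ^+ 2 = th k.+1 - th k - E * p k.+2.
    by rewrite /th /E /step2; ring.
  rewrite -!addrA !lerD2l /g.
  apply: (@le_trans _ _ (eta * p k.+2 ^+ 2 + E ^+ 2 / 4 / eta)).
    rewrite -subr_ge0 (_ : _ - _ = eta * (p k.+2 + E / (2 * eta)) ^+ 2).
      by rewrite mulr_ge0 ?sqr_ge0 // ltW.
    by field; rewrite gt_eqF.
  by rewrite lerD2l ler_pM2r ?invr_gt0 //; lra.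
apply: le_trans (ler_sum _ (fun k _ => loc k)) _.
rewrite 2!big_split /= S0 add0r -mulr_suml -!mulr_sumr !big_split /=.
apply: lerD; first by rewrite ler_pM2l // (le_trans gS2).
rewrite -[X in 5 / eta * X]/(\sum_(0 <= k < n) r k).
have A0 : 0 <= \sum_(0 <= k < n) r k by exact: sumr_ge0.
(* Three shifted residual sums of weight 3/2 make 9/2, rounded up to 5. *)
rewrite ler_pdivrMr // (_ : 5 / eta * _ * eta = 5 * \sum_(0 <= k < n) r k).
  by lra.
by field; rewrite gt_eqF.
Qed.

End FiniteSupport.

(** The slope K(e) of the half-planes: 5/(4 e^3) comes from bounding steps by residuals with [eta]
    equal to 2 e^2, and 8/e from the residuals that occur directly. *)
Definition skew_const (e : R) : R := 5 / (4 * e ^+ 3) + 8 / e.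

(** For x = p + iq the first sum is Im <Tx, x> and the second is Re <Tx, x>. The row values of T are
    a multiple of the sequence itself, which cancels in the skew form, plus a step and a residual,
    which are small. *)
Lemma skew_form_le p q n (e : R) : 0 < e ->
  p 0%N = 0 -> p 1%N = 0 -> (forall k, (n <= k)%N -> p k = 0) ->
  q 0%N = 0 -> q 1%N = 0 -> (forall k, (n <= k)%N -> q k = 0) ->
  \sum_(0 <= k < n) ((coef k * q k.+1 + q k.+2) * p k
                   - (coef k * p k.+1 + p k.+2) * q k) +
  skew_const e * \sum_(0 <= k < n) ((coef k * p k.+1 + p k.+2) * p k
                   + (coef k * q k.+1 + q k.+2) * q k) <=
  (3 / 2 * skew_const e + 2 * e) * \sum_(0 <= k < n) (p k ^+ 2 + q k ^+ 2).
Proof.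
move=> e0 p0 p1 ps q0 q1 qs; rewrite !big_split /=.
have := sum_resid_sq _ _ p0 p1 ps; have := sum_resid_sq _ _ q0 q1 qs.
have eta0 : 0 < 2 * e ^+ 2 by rewrite mulr_gt0 // exprn_gt0.
have := sum_step2_sq _ _ p0 p1 ps _ eta0.
have := sum_step2_sq _ _ q0 q1 qs _ eta0.
set Rp := \sum_(0 <= k < n) resid p k ^+ 2.
set Rq := \sum_(0 <= k < n) resid q k ^+ 2.
set Dp := \sum_(0 <= k < n) step2 p k ^+ 2.
set Dq := \sum_(0 <= k < n) step2 q k ^+ 2.
set Sp := \sum_(0 <= k < n) p k ^+ 2.
set Sq := \sum_(0 <= k < n) q k ^+ 2.
set Fp := \sum_(0 <= k < n) (_ * p k).
set Fq := \sum_(0 <= k < n) (_ * q k).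
rewrite -big_split /= => leDq leDp eqRq eqRp.
(* Young's inequality with weight [e], then (d + 4r)^2 / 4 <= d^2 / 2 + 8 r^2; the case of 2r is
   weaker. *)
have half (s r d a : R) : (s = - d - 2 * r) \/ (s = - d - 4 * r) ->
    s * a <= e * a ^+ 2 + (d ^+ 2 / 2 + 8 * r ^+ 2) / e.
  move=> sE; apply: (@le_trans _ _ (e * a ^+ 2 + s ^+ 2 / 4 / e)).
    rewrite -subr_ge0 (_ : _ - _ = e * (a - s / (2 * e)) ^+ 2).
      by rewrite mulr_ge0 ?sqr_ge0 // ltW.
    by field; rewrite gt_eqF.
  rewrite lerD2l ler_pM2r ?invr_gt0 //; case: sE => ->.
    by have := sqr_ge0 (d / 2 - r); have := sqr_ge0 r; lra.
  by have := sqr_ge0 (d / 2 - 2 * r); lra.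
(* The subtracted multiple has the same factor [coef k + 1] for [p] and [q], hence disappears from
   the antisymmetric expression in [loc]. *)
have shape (u : nat -> R) k (s := (coef k + 1) * u k) :
    coef k * u k.+1 + u k.+2 - s = - step2 u k - 2 * resid u k \/
    coef k * u k.+1 + u k.+2 - s = - step2 u k - 4 * resid u k.
  rewrite /s /coef /step2 /resid.
  by case: (odd k); [right|left]; field.
have loc k : (coef k * q k.+1 + q k.+2) * p k - (coef k * p k.+1 + p k.+2) * q k
    <= e * p k ^+ 2 + (step2 q k ^+ 2 / 2 + 8 * resid q k ^+ 2) / e
     + (e * q k ^+ 2 + (step2 p k ^+ 2 / 2 + 8 * resid p k ^+ 2) / e).
  have h1 := half _ _ _ (p k) (shape q k).
  have h2 := half _ _ _ (- q k) (shape p k).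
  by rewrite sqrrN in h2; apply: le_trans (lerD h1 h2); lra.
have leI : \sum_(0 <= k < n) ((coef k * q k.+1 + q k.+2) * p k
      - (coef k * p k.+1 + p k.+2) * q k) <=
    e * Sp + (Dq / 2 + 8 * Rq) / e + (e * Sq + (Dp / 2 + 8 * Rp) / e).
  apply: le_trans (ler_sum _ (fun k _ => loc k)) _.
  by rewrite !big_split /= -!mulr_suml !big_split /= -!mulr_suml -!mulr_sumr.
have -> : Fp = 3 / 2 * Sp - Rp by rewrite eqRp; ring.
have -> : Fq = 3 / 2 * Sq - Rq by rewrite eqRq; ring.
have leD (D S Q : R) : D <= 2 * e ^+ 2 * S + 5 / (2 * e ^+ 2) * Q ->
    D / 2 / e <= e * S + 5 / (4 * e ^+ 3) * Q.
  move=> h; rewrite -mulrA -invfM ler_pdivrMr ?mulr_gt0 //.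
  apply: le_trans h _; rewrite le_eqVlt; apply/orP; left; apply/eqP.
  by field; rewrite gt_eqF.
have := leD _ _ _ leDq; have := leD _ _ _ leDp.
move: leI; rewrite /skew_const !mulrDl => leI hp hq; apply: le_trans.
  by apply: lerD leI (lexx _).
lra.
Qed.

(** Reduction of arbitrary sequences to [skew_form_le]; the last summand pays for the truncation. *)
Lemma skew_partial_sum_le p q n (e : R) : 0 < e ->
  \sum_(0 <= k < n) ((coef k * q k.+1 + q k.+2) * p k
                   - (coef k * p k.+1 + p k.+2) * q k) +
  skew_const e * \sum_(0 <= k < n) ((coef k * p k.+1 + p k.+2) * p k
                   + (coef k * q k.+1 + q k.+2) * q k) <=
  (3 / 2 * skew_const e + 2 * e) * \sum_(0 <= k < n.+2) (p k ^+ 2 + q k ^+ 2) +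
  (2 + 2 * skew_const e) *
    ((p n ^+ 2 + q n ^+ 2) + (p n.+1 ^+ 2 + q n.+1 ^+ 2)).
Proof.
move=> e0.
have K0 : 0 <= skew_const e.
  by rewrite addr_ge0 // divr_ge0 ?ltW // mulr_gt0 // exprn_gt0.
set K := skew_const e in K0 *.
(* Two zeros are put in front, an even shift that preserves [coef], and entries from [n.+2] on are
   cut, so the terms with k < n are unchanged. *)
pose tr (u : nat -> R) k :=
  if k is k'.+2 then if (k' < n.+2)%N then u k' else 0 else 0.
have tr_supp u k : (n.+4 <= k)%N -> tr u k = 0.
  by case: k => [|[|k]] //= nk; rewrite ltnNge (nk : (n.+2 <= k)%N).
have trE u k : (k < n.+2)%N -> tr u k.+2 = u k by rewrite /tr => ->.
have tr0 u k : (n.+2 <= k)%N -> tr u k.+2 = 0.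
  by rewrite /tr leqNgt => /negPf->.
have tr_0 u : tr u 0%N = 0 by [].
have tr_1 u : tr u 1%N = 0 by [].
have coefSS k : coef k.+2 = coef k by rewrite /coef /= negbK.
clearbody tr.
have sumE (F G : nat -> R) : F 0%N = 0 -> F 1%N = 0 ->
    (forall k, (k < n)%N -> F k.+2 = G k) ->
    \sum_(0 <= k < n.+4) F k = \sum_(0 <= k < n) G k + (F n.+2 + F n.+3).
  move=> F0 F1 FG; rewrite 2?big_nat_recl // F0 F1 !add0r.
  rewrite 2?big_nat_recr //= addrA; congr (_ + _ + _).
  by apply: eq_big_nat => k /andP[_]; exact: FG.
have := skew_form_le _ _ _ _ e0 (tr_0 p) (tr_1 p) (tr_supp p)
  (tr_0 q) (tr_1 q) (tr_supp q).
rewrite -/K.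
rewrite (sumE _ (fun k => (coef k * q k.+1 + q k.+2) * p k
                   - (coef k * p k.+1 + p k.+2) * q k)); first last.
- by move=> k kn; rewrite !trE ?coefSS // ?ltnS ?(ltnW kn) ?(leqW (ltnW kn)).
- by rewrite !tr_1; ring.
- by rewrite !tr_0; ring.
rewrite (sumE _ (fun k => (coef k * p k.+1 + p k.+2) * p k
                   + (coef k * q k.+1 + q k.+2) * q k)); first last.
- by move=> k kn; rewrite !trE ?coefSS // ?ltnS ?(ltnW kn) ?(leqW (ltnW kn)).
- by rewrite !tr_1; ring.
- by rewrite !tr_0; ring.
rewrite (sumE _ (fun k => p k ^+ 2 + q k ^+ 2)); first last.
- by move=> k kn; rewrite !trE // ?(leqW (leqW kn)).
- by rewrite !tr_1; ring.
- by rewrite !tr_0; ring.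
rewrite !(trE _ n) // !(trE _ n.+1) // !tr0 // coefSS.
set I := \sum_(0 <= k < n) _; set F := \sum_(0 <= k < n) _.
set S := \sum_(0 <= k < n) _ => le_tr.
(* Of the terms created by the cut, only the coupling of [n] with [n.+1] survives in the two
   forms. *)
suff [h1 h2] : - (coef n * (q n.+1 * p n - p n.+1 * q n)) <=
      2 * ((p n ^+ 2 + q n ^+ 2) + (p n.+1 ^+ 2 + q n.+1 ^+ 2)) /\
   - (coef n * (p n.+1 * p n + q n.+1 * q n)) <=
      2 * ((p n ^+ 2 + q n ^+ 2) + (p n.+1 ^+ 2 + q n.+1 ^+ 2)).
  have h3 := ler_wpM2l K0 h2; rewrite 2?big_nat_recr //= -/S; lra.
move: (p n) (q n) (p n.+1) (q n.+1) => a b c d.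
have h1 := sqr_ge0 (a - d); have h2 := sqr_ge0 (b - c).
have h3 := sqr_ge0 (a - c); have h4 := sqr_ge0 (b - d).
have h5 := sqr_ge0 (a + d); have h6 := sqr_ge0 (b + c).
have h7 := sqr_ge0 (a + c); have h8 := sqr_ge0 (b + d).
have h9 := sqr_ge0 a; have h10 := sqr_ge0 b.
have h11 := sqr_ge0 c; have h12 := sqr_ge0 d.
by rewrite /coef; case: odd; split; lra.
Qed.

End RealForms.

(** * The half-planes containing the numerical range *)

(** The factors 1 and -1 are kept so that all four squares have the shape [a + c * b] handled by
    [ell2_addM]. *)
Lemma polarization (C : numClosedFieldType) (a b : C) :
  a * b^* = 4^-1 * ((`|a + 1 * b| ^+ 2 - `|a + -1 * b| ^+ 2) +
    'i * (`|a + 'i * b| ^+ 2 - `|a + - 'i * b| ^+ 2)).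
Proof.
rewrite !normCK !rmorphD !rmorphM !rmorphN !rmorph1 /= conjCi.
move: (a^*) (b^*) => a' b'.
have := sqrCi C; move: 'i => i i2.
rewrite (_ : _ + _ = 2 * (1 - i ^+ 2) * (a * b') + 2 * (1 + i ^+ 2) * (a' * b)).
  by rewrite i2; field.
by ring.
Qed.

Lemma is_cvg_comb4 (C : numFieldType) (a b : C) (f g h l : nat -> C) :
  cvgn f -> cvgn g -> cvgn h -> cvgn l ->
  cvgn (fun n => a * ((f n - g n) + b * (h n - l n)) : C).
Proof.
move=> cf cg ch cl.
exact: (is_cvgMl_tmp (is_cvgD (is_cvgB cf cg) (is_cvgMl_tmp (is_cvgB ch cl)))).
Qed.

Section Ell2.
Variable R : realType.
Local Notation C := (Cplx R).
Implicit Types (x y : nat -> C).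

Definition sqmod (z : C) : R := complex.Re z ^+ 2 + complex.Im z ^+ 2.

Lemma sqmod_ge0 z : 0 <= sqmod z.
Proof. by rewrite addr_ge0 ?sqr_ge0. Qed.

Lemma sqmodE (z : C) : `|z| ^+ 2 = (sqmod z)%:C%C.
Proof. by rewrite -add_Re2_Im2. Qed.

Lemma Re_sum (I : Type) (r : seq I) (F : I -> C) :
  complex.Re (\sum_(i <- r) F i) = \sum_(i <- r) complex.Re (F i).
Proof. by apply: (big_morph (@complex.Re R)) => // -[? ?] [? ?]. Qed.

Lemma Im_sum (I : Type) (r : seq I) (F : I -> C) :
  complex.Im (\sum_(i <- r) F i) = \sum_(i <- r) complex.Im (F i).
Proof. by apply: (big_morph (@complex.Im R)) => // -[? ?] [? ?]. Qed.

Lemma conjCE (z : C) : z^* = conjc z :> R[i].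
Proof. by []. Qed.

Lemma ell2_addM (c : C) x y : ell2 x -> ell2 y -> ell2 (fun k => x k + c * y k).
Proof.
move=> ex ey.
set a := fun k => `|x k| ^+ 2; set b := fun k => `|y k| ^+ 2.
have a0 k : 0 <= a k by rewrite exprn_ge0.
have b0 k : 0 <= b k by rewrite exprn_ge0.
have c0 : 0 <= `|c| ^+ 2 by rewrite exprn_ge0.
apply: (proj1 (@nneg_series_bounded _ _
  (2 * limn (series a : nat -> C) +
   2 * `|c| ^+ 2 * limn (series b : nat -> C)) _ _)).
  by move=> k; rewrite exprn_ge0.
move=> n; apply: (@le_trans _ _ (2 * series a n + 2 * `|c| ^+ 2 * series b n)).
  rewrite /series /= !mulr_sumr -big_split /=; apply: ler_sum => k _.
  rewrite /a /b; apply: (@le_trans _ _ ((`|x k| + `|c| * `|y k|) ^+ 2)).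
    rewrite lerXn2r ?nnegrE ?addr_ge0 ?mulr_ge0 //.
    by rewrite -normrM ler_normD.
  rewrite -subr_ge0 (_ : _ - _ = (`|x k| - `|c| * `|y k|) ^+ 2); last by ring.
  by rewrite real_exprn_even_ge0 // rpredB ?rpredM ?normr_real.
have two0 : 0 <= 2 :> C by exact: (ler0n C 2).
apply: lerD; first exact: ler_wpM2l two0 _ _ (nneg_series_le n a0 ex).
exact: ler_wpM2l (mulr_ge0 two0 c0) _ _ (nneg_series_le n b0 ey).
Qed.

(* Polarization reduces the convergence to that of four nonnegative series. *)
Lemma ell2_dot_cvg x y : ell2 x -> ell2 y ->
  cvgn (series (fun k => x k * (y k)^*) : nat -> C).
Proof.
move=> ex ey.
pose P (c : C) := series (fun k => `|x k + c * y k| ^+ 2) : nat -> C.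
have cP c : cvgn (P c) by exact: ell2_addM.
pose Q n := 4^-1 * ((P 1 n - P (-1) n) + 'i * (P 'i n - P (- 'i) n)) : C.
rewrite (_ : (series _ : nat -> C) = Q).
  exact: is_cvg_comb4 (cP 1) (cP (-1)) (cP 'i) (cP (- 'i)).
apply: funext => n; rewrite /Q /P /series /= -!sumrB mulr_sumr -big_split /=.
by rewrite mulr_sumr; apply: eq_bigr => k _; exact: polarization.
Qed.


Lemma Tplus_coefE x k : Tplus x k = (coef R k)%:C%C * x k.+1 + x k.+2.
Proof.
rewrite TplusE; congr (_ * _ + _); rewrite /coef.
by case: odd; rewrite ?rmorphN ?rmorph_nat ?rmorph1.
Qed.

(** The truncation error is expressed through partial sums of the squared norm, so that it tends to
    0 for [x] in [ell2]. *)
Lemma Tplus_partial_sum_le x n (e : R)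
    (s : C := \sum_(0 <= k < n) Tplus x k * (x k)^*) :
  0 < e ->
  complex.Im s + skew_const R e * complex.Re s <=
  (3 / 2 * skew_const R e + 2 * e) * \sum_(0 <= k < n.+2) sqmod (x k) +
  (2 + 2 * skew_const R e) *
     (\sum_(0 <= k < n.+2) sqmod (x k) - \sum_(0 <= k < n) sqmod (x k)).
Proof.
move=> e0.
have := skew_partial_sum_le R (fun k => complex.Re (x k))
  (fun k => complex.Im (x k)) n e e0.
rewrite -/(sqmod (x n)) -/(sqmod (x n.+1)) => le.
have -> : \sum_(0 <= k < n.+2) sqmod (x k) - \sum_(0 <= k < n) sqmod (x k) =
    sqmod (x n) + sqmod (x n.+1) by rewrite 2?big_nat_recr //=; ring.
apply: le_trans le; rewrite le_eqVlt; apply/orP; left; apply/eqP.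
rewrite /s Im_sum Re_sum; congr (_ + _ * _); apply: eq_bigr => k _;
  rewrite Tplus_coefE conjCE;
  case: (x k) (x k.+1) (x k.+2) => [a b] [c d] [f g] /=; ring.
Qed.

Lemma series_sqnormE x n :
  series (fun k => `|x k| ^+ 2) n = (\sum_(0 <= k < n) sqmod (x k))%:C%C :> C.
Proof.
rewrite rmorph_sum /series /=; apply: eq_bigr => k _.
by rewrite -add_Re2_Im2.
Qed.

Lemma ell2_dot_sqnorm x :
  ell2_dot x x = limn (series (fun k => `|x k| ^+ 2) : nat -> C).
Proof.
rewrite /ell2_dot; congr (limn (series _ : nat -> C)).
by apply: funext => k; rewrite normCK.
Qed.

Lemma hnorm_ell2_eq1 x : hnorm (@ell2_dot C) x = 1 -> ell2_dot x x = 1.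
Proof. by move=> /(congr1 (fun z => z ^+ 2)); rewrite /hnorm sqrtCK expr1n. Qed.

Lemma Tplus_numrange_le (e : R) (z : C) : 0 < e ->
  numrange (@ell2 C) (@ell2_dot C) (@Tplus C) z ->
  complex.Im z + skew_const R e * complex.Re z <=
  3 / 2 * skew_const R e + 2 * e.
Proof.
move=> e0 [x [ex /hnorm_ell2_eq1 nx] <-].
have [eTx _] := Tplus_bounded ex.
set K := skew_const R e.
pose s n : C := \sum_(0 <= k < n) Tplus x k * (x k)^*.
have cs : s @ \oo --> ell2_dot (Tplus x) x by exact: ell2_dot_cvg.
pose N n : R := \sum_(0 <= k < n) sqmod (x k).
have cN : N @ \oo --> (1 : R).
  have cx : (series (fun k => `|x k| ^+ 2) : nat -> C) @ \oo --> (1 : C).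
    by rewrite -nx ell2_dot_sqnorm; exact: ex.
  have -> : N = fun n => complex.Re (series (fun k => `|x k| ^+ 2) n : C).
    by apply: funext => n; rewrite series_sqnormE.
  exact: Re_cvg cx.
have cN2 : (fun n => N n.+2) @ \oo --> (1 : R).
  have -> : (fun n => N n.+2) = (fun n => N (n + 2)%N).
    by apply: funext => n; rewrite addn2.
  by rewrite cvg_shiftn.
have cl := cvgD (Im_cvg cs) (cvgMl_tmp (a := K) (Re_cvg cs)).
have cr := cvgD (cvgMl_tmp (a := 3 / 2 * K + 2 * e) cN2)
  (cvgMl_tmp (a := 2 + 2 * K) (cvgB cN2 cN)).
rewrite subrr mulr0 addr0 mulr1 in cr.
apply: (ler_cvg_to (cl _ _) (cr _ _ _ _)); apply: nearW => n.
exact: Tplus_partial_sum_le.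
Qed.

End Ell2.

Arguments sqmod {R} z.
Arguments sqmod_ge0 {R} z.

(** * Bloch waves *)

Section PlaneWaves.
Variables (C : numClosedFieldType) (z : C).
Hypothesis z1 : z * z^* = 1.

Definition wave k : C := z ^+ (k./2 + (odd k).*2).
Definition wave_val : C := z + z^* - z ^+ 2 / 2.

Lemma exp_mul_conj j : z ^+ j * (z ^+ j)^* = 1.
Proof. by rewrite rmorphXn -exprMn z1 expr1n. Qed.

Lemma wave_unit k : wave k * (wave k)^* = 1.
Proof. exact: exp_mul_conj. Qed.

Lemma wave_even m : wave m.*2 = z ^+ m.
Proof. by rewrite /wave odd_double doubleK addn0. Qed.

Lemma wave_odd m : wave m.*2.+1 = z ^+ m * z ^+ 2.
Proof. by rewrite /wave /= odd_double /= uphalf_double -exprD. Qed.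

Lemma wave_edge m : wave m.*2.+1 * (wave m.*2)^* = z ^+ 2.
Proof. by rewrite wave_even wave_odd mulrAC exp_mul_conj mul1r. Qed.

(** Since z is unimodular, rows 2m and 2m + 1 contribute z - z^2 and z + 2 conj z, independently of
    m. *)
Lemma sum_wave m :
  \sum_(0 <= k < m.*2) Tplus wave k * (wave k)^* = m.*2%:R * wave_val.
Proof.
elim: m => [|m IHm]; first by rewrite big_nil mul0r.
rewrite doubleS 2?big_nat_recr //= {}IHm -addrA -addn2 natrD mulrDl.
congr (_ + _); rewrite !TplusE /= odd_double /= -doubleS wave_odd !wave_even.
rewrite wave_odd rmorphM /= [z ^+ m.+1]exprS.
have := exp_mul_conj m; have : z ^+ 2 * (z ^+ 2)^* = 1 := exp_mul_conj 2.
rewrite /wave_val [(z ^+ 2)^*]rmorphXn /=.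
move: (z ^+ m) ((z ^+ m)^*) (z^*) z1 => a b c zc _ ab.
transitivity ((- z ^+ 2 + z + 2 * (z * c) * c + (z * c) ^+ 2 * z) * (a * b)).
  by ring.
by rewrite ab zc; field.
Qed.

End PlaneWaves.

(** * Points of the closure from truncated waves, and half-planes containing it *)

Section Closure.
Variable R : realType.
Local Notation C := (Cplx R).

Lemma series_finsupp_cvg (u : nat -> C) (N : nat) :
  (forall k, (N <= k)%N -> u k = 0) -> cvgn (series u : nat -> C).
Proof.
move=> u0; apply/cvg_ex; exists (\sum_(0 <= k < N) u k); apply: cvg_near_cst.
exists N => // n /= leNn; rewrite /series /= (big_cat_nat (leq0n N) leNn) //=.
rewrite [X in _ + X](_ : _ = 0) ?addr0 // big_nat_cond big1 // => i.
by rewrite andbT => /andP[Ni _]; exact: u0.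
Qed.

(** The wave is cut after 2m + 2 entries and normalized. The first 2m rows are intact; row 2m keeps
    only its edge term, giving - z^2, and row 2m + 1 gives 0. *)
Lemma numrange_wave (z : C) m : z * z^* = 1 ->
  numrange (@ell2 C) (@ell2_dot C) (@Tplus C)
    ((m.*2%:R * wave_val C z - z ^+ 2) / m.*2.+2%:R).
Proof.
move=> z1; set N := m.*2.+2.
have N0 : N%:R != 0 :> C by rewrite pnatr_eq0.
pose l : C := (sqrtC N%:R)^-1.
have ll : l * l^* = N%:R^-1.
  have lge0 : 0 <= l by rewrite invr_ge0 sqrtC_ge0 ler0n.
  by rewrite (CrealP (ger0_real lge0)) -invfM -expr2 sqrtCK.
pose x k := if (k < N)%N then l * wave C z k else 0.
have x0 k : (N <= k)%N -> x k = 0 by rewrite /x leqNgt => /negPf->.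
have xE k : (k < N)%N -> x k = l * wave C z k by rewrite /x => ->.
exists x; first split.
- apply: (@series_finsupp_cvg _ N) => k /x0 ->.
  by rewrite normr0 expr0n.
- rewrite /hnorm /ell2_dot (@limn_series_finsupp _ _ N); last first.
    by move=> k /x0 ->; rewrite mul0r.
  rewrite (eq_big_nat _ _ (F2 := fun=> N%:R^-1)) => [|k /andP[_ kN]].
    by rewrite sumr_const_nat subn0 -[_ *+ _]mulr_natr mulVf // sqrtC1.
  by rewrite xE // rmorphM mulrACA wave_unit // mulr1.
rewrite /ell2_dot (@limn_series_finsupp _ _ N); last first.
  by move=> k /x0 ->; rewrite conjC0 mulr0.
rewrite 2?big_nat_recr //= !TplusE odd_double /= (xE m.*2) // (xE m.*2.+1) //.
rewrite (x0 m.*2.+2) // (x0 m.*2.+3) //.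
rewrite mulr0 !addr0 mul0r addr0 -(wave_edge _ _ z1 m) -(sum_wave _ _ z1 m).
rewrite mulrBl mulr_suml; congr (_ + _).
  apply: eq_big_nat => k /andP[_ km].
  rewrite !TplusE !xE ?ltnS ?(ltnW km) ?(leqW (ltnW km)) ?(leqW km) //.
  rewrite -ll !rmorphM; ring.
by rewrite -ll !rmorphM; ring.
Qed.

Lemma wave_val_closure (z : C) : z * z^* = 1 ->
  closure (numrange (@ell2 C) (@ell2_dot C) (@Tplus C)) (wave_val C z).
Proof.
move=> z1 B /nbhs_ballP[r /= r0 rB].
(* [D] divided by 2m + 2 is the difference between [w] and the value at the truncated wave. *)
set w := wave_val C z; set D := 2 * w + z ^+ 2.
(* The Archimedean property is applied in [R], to the real parts of these two nonnegative complex
   numbers. *)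
have [m lt_m] : exists m, `|D| < r * m%:R.
  have : `|D| = (complex.Re `|D|)%:C%C by rewrite RRe_real // normr_real.
  have : r = (complex.Re r)%:C%C by rewrite RRe_real // ger0_real // ltW.
  move: (complex.Re r) (complex.Re `|D|) => b a rE DE.
  have b0 : 0 < b by move: r0; rewrite rE (ltcR 0 b).
  have a0 : 0 <= a by rewrite -(lecR 0 a) -DE normr_ge0.
  exists (Num.bound (a / b)); rewrite rE DE -(rmorph_nat (real_complex R)).
  rewrite -rmorphM ltcR mulrC -ltr_pdivrMr //.
  by apply: archi_boundP; rewrite divr_ge0 // ltW.
exists ((m.*2%:R * w - z ^+ 2) / m.*2.+2%:R); split; first exact: numrange_wave.
apply: rB; rewrite -ball_normE /ball_ /=.
have N0 : 0 < m.*2.+2%:R :> C by rewrite ltr0n.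
have -> : w - (m.*2%:R * w - z ^+ 2) / m.*2.+2%:R = D / m.*2.+2%:R.
  rewrite -addn2 natrD /D in N0 *; field.
  by rewrite gt_eqF.
rewrite normrM normfV [X in _ / X]gtr0_norm // ltr_pdivrMr //.
apply: lt_le_trans lt_m _; rewrite ler_pM2l // ler_nat.
by rewrite -addnn; apply: leq_trans (leq_addr m m) _; rewrite -addn2 leq_addr.
Qed.

Lemma closure_halfplane (A : set C) (K c : R) : 0 <= K ->
  (forall z, A z -> complex.Im z + K * complex.Re z <= c) ->
  forall z, closure A z -> complex.Im z + K * complex.Re z <= c.
Proof.
move=> K0 Ac z Az; rewrite leNgt; apply/negP => ltc.
(* A move of modulus less than [g] lowers Im + K Re by less than (1 + K) g, which is the assumed
   excess over [c]. *)
pose g := (complex.Im z + K * complex.Re z - c) / (1 + K).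
have K1 : 0 < 1 + K by rewrite ltr_pwDl.
have g0 : 0 < g by rewrite divr_gt0 // subr_gt0.
have g0C : (0 : C) < (g%:C)%C by rewrite ltcR.
have [w [Aw]] := Az _ (nbhsx_ballx z _ g0C).
rewrite -ball_normE /ball_ /= => lt_g.
have hI : `|complex.Im (z - w)| < g.
  by rewrite -ltcR; apply: le_lt_trans (normc_ge_Im _) lt_g.
have hR : `|complex.Re (z - w)| < g.
  by rewrite -ltcR; apply: le_lt_trans (normc_ge_Re _) lt_g.
have := Ac _ Aw; have gE : g * (1 + K) = complex.Im z + K * complex.Re z - c.
  by rewrite /g mulfVK // gt_eqF.
have hI' : complex.Im z - complex.Im w < g.
  apply: le_lt_trans hI; rewrite (le_trans _ (ler_norm _)) //.
  by case: (z) (w) => [? ?] [? ?].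
have hR' : complex.Re z - complex.Re w < g.
  apply: le_lt_trans hR; rewrite (le_trans _ (ler_norm _)) //.
  by case: (z) (w) => [? ?] [? ?].
have := ler_wpM2l K0 (ltW hR'); lra.
Qed.

End Closure.

(** * Numerical ranges of matrices *)

Section QuadraticForm.
Local Open Scope sesquilinear_scope.
Variable C : numClosedFieldType.

Definition qform {n} (B : 'M[C]_n) (y : 'cV[C]_n) : C := (y^t* *m B *m y) 0 0.

Lemma qformE n (B : 'M[C]_n) y :
  qform B y = \sum_i \sum_j (y i 0)^* * B i j * y j 0.
Proof.
rewrite /qform mxE exchange_big /=; apply: eq_bigr => j _.
by rewrite mxE mulr_suml; apply: eq_bigr => i _; rewrite !mxE.
Qed.

Lemma dotmx_qform n (B : 'M[C]_n) y : dotmx (B *m y)^T y^T = qform B y.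
Proof.
rewrite dotmxE /qform -mulmxA mxE [RHS]mxE; apply: eq_bigr => i _.
by rewrite mulrC; congr (_ * _); rewrite !mxE.
Qed.

Lemma qform_conj n (B : 'M[C]_n) y : (qform B y)^* = qform (B^t*) y.
Proof.
have -> : (qform B y)^* = (y^t* *m B *m y)^t* 0 0 by rewrite 2!mxE.
by rewrite /qform !trmx_mul !map_mxM trmxCK mulmxA.
Qed.

Lemma qformD n (A B : 'M[C]_n) y : qform (A + B) y = qform A y + qform B y.
Proof. by rewrite /qform mulmxDr mulmxDl mxE. Qed.

Lemma qform_unitary n (U B : 'M[C]_n) y :
  qform (U^t* *m B *m U) y = qform B (U *m y).
Proof. by rewrite /qform trmx_mul map_mxM !mulmxA. Qed.

Lemma qform_diag n (d : 'rV[C]_n) y :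
  qform (diag_mx d) y = \sum_i d 0 i * `|y i 0| ^+ 2.
Proof.
rewrite qformE; apply: eq_bigr => i _; rewrite (bigD1 i) //= big1 ?addr0.
  by rewrite mxE eqxx mulr1n normCK; ring.
by move=> j /negPf ji; rewrite mxE eq_sym ji mulr0n mulr0 mul0r.
Qed.

Lemma qform1 n (y : 'cV[C]_n) : qform 1%:M y = \sum_i `|y i 0| ^+ 2.
Proof.
rewrite -diag_const_mx qform_diag; apply: eq_bigr => i _.
by rewrite mxE mul1r.
Qed.

(** The spectral theorem applied to the Hermitian matrix B + B^t*. Being unitarily invariant, the
    numerical range may then be computed from [A]. *)
Lemma unitary_realpart_diag n (B : 'M[C]_n) :
  exists (U A : 'M[C]_n) (d : 'rV[C]_n),
    [/\ U \is unitarymx, B = U^t* *m A *m U & A + A^t* = diag_mx d].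
Proof.
pose P := B + B^t*.
have PE : P^t* = P by rewrite /P linearD /= map_mxD trmxCK addrC.
have /orthomx_spectralP : P \is normalmx by apply/normalmxP; rewrite PE.
set U := spectralmx P; set d := spectral_diag P => Pd.
have Uu : U \is unitarymx := spectral_unitarymx P.
have UU : U *m U^t* = 1%:M := unitarymxP Uu.
have U'U : U^t* *m U = 1%:M.
  by rewrite -(invmx_unitary Uu) mulVmx ?unitarymx_unit.
exists U, (U *m B *m U^t*), d; split => //.
  by rewrite !mulmxA U'U mul1mx -mulmxA U'U mulmx1.
have -> : (U *m B *m U^t*)^t* = U *m B^t* *m U^t*.
  by rewrite !trmx_mul !map_mxM trmxCK mulmxA.
rewrite -mulmxDl -mulmxDr -/P [in LHS]Pd invmx_unitary // !mulmxA UU mul1mx.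
by rewrite -mulmxA UU mulmx1.
Qed.

End QuadraticForm.

(** * Contact of a matrix numerical range with the line Re = 3/2 *)

Section ComplexForm.
Local Open Scope sesquilinear_scope.
Variable R : realType.
Local Notation C := (Cplx R).

Lemma Im_le_norm (z : C) : ((complex.Im z)%:C)%C <= `|z|.
Proof. by apply: le_trans (normc_ge_Im z); rewrite lecR ler_norm. Qed.

Lemma ImD (a b : C) : complex.Im (a + b) = complex.Im a + complex.Im b.
Proof. by case: a b => [? ?] [? ?]. Qed.

Section Diag.
Variables (n : nat) (A : 'M[C]_n) (d : 'rV[C]_n).
Hypothesis Ad : A + A^t* = diag_mx d.
Implicit Types y : 'cV[C]_n.

Definition vsq y : R := \sum_i sqmod (y i 0).
(** As [d] is the diagonal of twice the real part of [A], the constant is 3 rather than 3/2; the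
    zeros of [defect] mark the eigenvalue 3/2. *)
Definition defect i : R := 3 - complex.Re (d 0 i).

Lemma qform1_vsq y : qform C 1%:M y = (vsq y)%:C%C.
Proof. by rewrite qform1 rmorph_sum; apply: eq_bigr => i _; rewrite sqmodE. Qed.

Lemma Re_qform y :
  3 / 2 * vsq y - complex.Re (qform C A y) =
  2^-1 * \sum_i defect i * sqmod (y i 0).
Proof.
have : complex.Re (qform C A y) + complex.Re (qform C A y) =
    \sum_i complex.Re (d 0 i) * sqmod (y i 0).
  have -> : \sum_i complex.Re (d 0 i) * sqmod (y i 0) =
      complex.Re (qform C (A + A^t*) y).
    rewrite Ad qform_diag Re_sum; apply: eq_bigr => i _.
    by rewrite sqmodE; case: (d 0 i) => a b /=; rewrite mulr0 subr0.
  rewrite qformD -qform_conj; case: (qform C A y) => a b //=.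
move=> h; rewrite (_ : \sum_i defect i * _ =
  3 * vsq y - \sum_i complex.Re (d 0 i) * sqmod (y i 0)).
  by rewrite -h; field.
by rewrite mulr_sumr -sumrB; apply: eq_bigr => i _; rewrite mulrBl.
Qed.

Hypothesis ReA : forall y, vsq y = 1 -> complex.Re (qform C A y) <= 3 / 2.
Hypothesis ImA : forall e, 0 < e -> exists K : R, forall y, vsq y = 1 ->
  complex.Im (qform C A y) + K * complex.Re (qform C A y) <= 3 / 2 * K + 2 * e.

Lemma defect_ge0 i : 0 <= defect i.
Proof.
pose y : 'cV[C]_n := delta_mx i 0.
have yE j : sqmod (y j 0) = (j == i)%:R.
  rewrite mxE eqxx andbT /sqmod; case: eqP => _ /=;
  by rewrite ?expr1n expr0n /= ?addr0.
have sumE (F : 'I_n -> R) : \sum_j F j * sqmod (y j 0) = F i.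
  rewrite (bigD1 i) //= yE eqxx mulr1 big1 ?addr0 // => j /negPf ji.
  by rewrite yE ji mulr0.
have y1 : vsq y = 1.
  rewrite /vsq -(sumE (fun=> 1)); apply: eq_bigr => j _; by rewrite mul1r.
have := Re_qform y; rewrite sumE y1; have := ReA y y1; lra.
Qed.

Lemma qformZ (c : R) y : qform C A (c%:C%C *: y) = (c ^+ 2)%:C%C * qform C A y.
Proof.
have cE : (c%:C%C : C)^* = c%:C%C by exact: conjc_real.
rewrite rmorphXn /=; move: (c%:C%C : C) cE => c' cE.
rewrite !qformE mulr_sumr; apply: eq_bigr => i _; rewrite mulr_sumr.
by apply: eq_bigr => j _; rewrite !mxE rmorphM /= cE; ring.
Qed.

Lemma vsqZ (c : R) y : vsq (c%:C%C *: y) = c ^+ 2 * vsq y.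
Proof.
rewrite /vsq mulr_sumr; apply: eq_bigr => i _; rewrite mxE /sqmod.
by case: (y i 0) => a b /=; ring.
Qed.

(** On such vectors the real part is exactly 3/2 |y|^2, so K cancels from [ImA] and, for normalized
    y, Im <= 2e remains for every e > 0. *)
Lemma Im_qform_kernel y : (forall i, defect i != 0 -> y i 0 = 0) ->
  complex.Im (qform C A y) <= 0.
Proof.
move=> yZ.
have Re0 : complex.Re (qform C A y) = 3 / 2 * vsq y.
  have := Re_qform y; rewrite big1 => [|i _]; first by rewrite mulr0; lra.
  have [->|/yZ ->] := eqVneq (defect i) 0; first by rewrite mul0r.
  by rewrite /sqmod /= expr0n addr0 mulr0.
have : 0 <= vsq y by apply: sumr_ge0 => i _; exact: sqmod_ge0.
rewrite le_eqVlt => /orP[/eqP y0|y0].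
  have -> : y = 0.
    apply/colP => i; rewrite mxE; apply/eqP.
    rewrite -normr_eq0 -sqrf_eq0 sqmodE.
    have /psumr_eq0P : vsq y = 0 by [].
    by move=> /(_ (fun j _ => sqmod_ge0 (y j 0))) ->.
  by rewrite /qform mulmx0 mxE.
pose c := (Num.sqrt (vsq y))^-1.
have c2 : c ^+ 2 = (vsq y)^-1 by rewrite exprVn sqr_sqrtr // ltW.
rewrite leNgt; apply/negP => I0.
pose a := complex.Im (qform C A y) / vsq y.
have a0 : 0 < a by rewrite divr_gt0.
(* With this e the bound 2e is a/2, below the normalized imaginary part a. *)
have e0 : 0 < a / 4 by rewrite divr_gt0.
have [K /(_ (c%:C%C *: y))] := ImA _ e0.
rewrite vsqZ qformZ c2 mulVf ?gt_eqF // => /(_ erefl).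
have -> : complex.Im (((vsq y)^-1)%:C%C * qform C A y) = a.
  by rewrite /a; case: (qform C A y) => ? ? /=; ring.
have -> : complex.Re (((vsq y)^-1)%:C%C * qform C A y) = 3 / 2.
  rewrite (_ : complex.Re _ = (vsq y)^-1 * complex.Re (qform C A y)).
    by rewrite Re0; field; rewrite gt_eqF.
  by case: (qform C A y) => ? ? /=; ring.
lra.
Qed.

(** As g^2 is half the sum of the [defect i * sqmod (y i 0)], each coordinate with nonzero defect is
    at most a constant times g. Dropping those coordinates leaves a vector [u] with nonpositive
    imaginary part, and every term of the difference contains a dropped coordinate. *)
Lemma Im_qform_le_sqrt : exists2 M : R, 0 <= M &
  forall y g, vsq y = 1 -> 0 <= g ->
  3 / 2 - complex.Re (qform C A y) = g ^+ 2 ->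
  complex.Im (qform C A y) <= M * g.
Proof.
(* Indices of zero defect contribute 0, by the convention for division by 0. *)
pose h := \sum_i Num.sqrt (2 / defect i).
have h0 : 0 <= h by apply: sumr_ge0 => i _; exact: sqrtr_ge0.
pose S : C := \sum_i \sum_j `|A i j|.
have S0 : 0 <= S by apply: sumr_ge0 => i _; exact: sumr_ge0.
have SE : S = (complex.Re S)%:C%C by rewrite RRe_real // ger0_real.
have S0' : 0 <= complex.Re S by rewrite -(lecR 0) -SE.
exists (complex.Re S * h) => [|y g y1 g0 Py]; first exact: mulr_ge0.
have y_le1 i : `|y i 0| <= 1.
  rewrite -(expr_le1 (n := 2)) // sqmodE (lecR _ 1) -y1.
  rewrite /vsq (bigD1 i) //= lerDl.
  by apply: sumr_ge0 => j _; exact: sqmod_ge0.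
have gh0 : (0 : C) <= ((g * h)%:C)%C by rewrite (lecR 0) mulr_ge0.
have y_small i : defect i != 0 -> `|y i 0| <= ((g * h)%:C)%C.
  move=> di; have di0 : 0 < defect i by rewrite lt_neqAle eq_sym di defect_ge0.
  rewrite -(ler_pXn2r (n := 2)) ?nnegrE // sqmodE -rmorphXn lecR exprMn.
  have le_h : Num.sqrt (2 / defect i) <= h.
    by rewrite /h (bigD1 i) //= lerDl; apply: sumr_ge0 => j _; exact: sqrtr_ge0.
  apply: (@le_trans _ _ (g ^+ 2 * (2 / defect i))); last first.
    have q0 : 0 <= 2 / defect i by rewrite divr_ge0 // ltW.
    apply: ler_wpM2l; first exact: sqr_ge0.
    by rewrite -[leLHS](sqr_sqrtr q0) lerXn2r // nnegrE sqrtr_ge0.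
  rewrite mulrA ler_pdivlMr // -Py.
  have := Re_qform y; rewrite y1 mulr1 => ->.
  rewrite [2^-1 * _]mulrC mulfVK ?pnatr_eq0 // (bigD1 i) //= mulrC lerDl.
  by apply: sumr_ge0 => j _; rewrite mulr_ge0 ?defect_ge0 ?sqmod_ge0.
pose u : 'cV[C]_n := \col_i (if defect i == 0 then y i 0 else 0).
have u0 : complex.Im (qform C A u) <= 0.
  by apply: Im_qform_kernel => i /negPf di; rewrite mxE di.
rewrite -[qform C A y](subrK (qform C A u)) ImD -[leRHS]addr0 lerD //.
rewrite -lecR; apply: le_trans (Im_le_norm _) _.
rewrite !qformE -sumrB; apply: le_trans (ler_norm_sum _ _ _) _.
rewrite -mulrA [h * g]mulrC rmorphM /= -SE mulr_suml; apply: ler_sum => i _.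
rewrite -sumrB mulr_suml; apply: le_trans (ler_norm_sum _ _ _) _.
apply: ler_sum => j _; rewrite !mxE.
have term0 (a b c : C) : `|b| <= 1 -> `|a| <= ((g * h)%:C)%C ->
    `|a^* * c * b| <= `|c| * ((g * h)%:C)%C /\
    `|b^* * c * a| <= `|c| * ((g * h)%:C)%C.
  move=> b1 a1; rewrite !normrM !norm_conjC; split.
    rewrite mulrAC mulrC; apply: ler_wpM2l => //.
    by apply: le_trans a1; rewrite ler_piMr.
  rewrite mulrAC mulrC; apply: ler_wpM2l => //.
  by apply: le_trans a1; rewrite ler_piMl.
(* If both defects vanish, the terms of [y] and [u] cancel; otherwise the [u] term is 0 and one
   factor of the [y] term is small. *)
have [i0|i0] := eqVneq (defect i) 0; have [j0|j0] := eqVneq (defect j) 0.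
- by rewrite subrr normr0 mulr_ge0.
- rewrite mulr0 subr0; apply: (term0 _ _ _ _ _).2;
    by [exact: y_le1|exact: y_small].
- rewrite conjC0 !mul0r subr0; apply: (term0 _ _ _ _ _).1;
    by [exact: y_le1|exact: y_small].
- rewrite mulr0 subr0; apply: (term0 _ _ _ _ _).1;
    by [exact: y_le1|exact: y_small].
Qed.

End Diag.
End ComplexForm.

(** * Comparison of [Tplus] with a matrix *)

Section TplusVersusMatrix.
Local Open Scope sesquilinear_scope.
Variable R : realType.
Local Notation C := (Cplx R).
Local Notation WT := (numrange (@ell2 C) (@ell2_dot C) (@Tplus C)).

Lemma unit_circle_mul_conj (c s : R) : c ^+ 2 + s ^+ 2 = 1 ->
  (Complex c (- s) : C) * (Complex c (- s) : C)^* = 1.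
Proof.
move=> cs; rewrite conjCE; apply/eqP; rewrite eq_complex /=.
by apply/andP; split; apply/eqP; rewrite -?cs; ring.
Qed.

(** Taking - s as imaginary part puts the wave value in the upper half-plane for c, s > 0, the side
    on which the matrix bound acts. *)
Lemma wave_val_complex (c s : R) : c ^+ 2 + s ^+ 2 = 1 ->
  wave_val C (Complex c (- s)) = Complex (3 / 2 - (1 - c) ^+ 2) (s * c).
Proof.
move=> cs; rewrite /wave_val conjCE.
have -> : (2 : C)^-1 = (2^-1)%:C%C by rewrite fmorphV rmorph_nat.
apply/eqP; rewrite expr2 eq_complex /=.
have s2 : s ^+ 2 = 1 - c ^+ 2 by rewrite -cs; ring.
apply/andP; split; apply/eqP; last by field.
by transitivity (2 * c - (c ^+ 2 - s ^+ 2) / 2); [field|rewrite s2; field].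
Qed.

Lemma mx_numrangeE n (B U A : 'M[C]_n) (w : C) :
  U \is unitarymx -> B = U^t* *m A *m U ->
  mx_numrange B w <-> exists2 y, vsq R n y = 1 & qform C A y = w.
Proof.
move=> Uu ->; have UU : U *m U^t* = 1%:M := unitarymxP Uu.
have U'U : U^t* *m U = 1%:M.
  by rewrite -(invmx_unitary Uu) mulVmx ?unitarymx_unit.
have vsqU x : qform C 1%:M x = (vsq R n (U *m x))%:C%C.
  by rewrite -qform1_vsq -qform_unitary mulmx1 U'U.
have norm1 x : dotmx x^T x^T = qform C 1%:M x by rewrite -dotmx_qform mul1mx.
split=> [[x [_ /(congr1 (fun z => z ^+ 2))]]|[y y1 <-]].
  rewrite /hnorm sqrtCK expr1n norm1 vsqU => x1 <-.
  exists (U *m x); first exact: (complexI x1).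
  by rewrite -qform_unitary dotmx_qform.
exists (U^t* *m y); first split=> //.
  by rewrite /hnorm norm1 vsqU mulmxA UU mul1mx y1 sqrtC1.
by rewrite dotmx_qform qform_unitary mulmxA UU mul1mx.
Qed.

Lemma skew_const_ge (e : R) : 0 < e -> 8 / e <= skew_const R e.
Proof.
by move=> e0; rewrite lerDr divr_ge0 // mulr_ge0 // exprn_ge0 // ltW.
Qed.

Lemma Tplus_closure_le (e : R) z : 0 < e -> closure WT z ->
  complex.Im z + skew_const R e * complex.Re z <=
  3 / 2 * skew_const R e + 2 * e.
Proof.
move=> e0; have K0 : 0 <= skew_const R e.
  by apply: le_trans (skew_const_ge _ e0); rewrite divr_ge0 // ltW.
by apply: (closure_halfplane _ _ _ _ K0) => w; exact: Tplus_numrange_le.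
Qed.

(** The half-planes have slope at least 8/e; as e tends to 0 their boundaries turn vertical. *)
Lemma Re_Tplus_closure_le z : closure WT z -> complex.Re z <= 3 / 2.
Proof.
move=> Wz; rewrite leNgt; apply/negP => h0.
set h := complex.Re z - 3 / 2; have {}h0 : 0 < h by rewrite subr_gt0.
set I := `|complex.Im z|; have I0 : 0 <= I by exact: normr_ge0.
(* With e = h/D <= 1 the slope times h is at least 8 D, while the half-plane allows at most I +
   2. *)
pose D := 1 + I + h; have D0 : 0 < D by rewrite /D; lra.
pose e := h / D; have e0 : 0 < e by rewrite divr_gt0.
have := Tplus_closure_le _ _ e0 Wz.
have e1 : e <= 1 by rewrite ler_pdivrMr // /D; lra.
have := ler_wpM2r (ltW h0) (skew_const_ge _ e0).
rewrite (_ : 8 / e * h = 8 * D); last by rewrite /e; field; rewrite !gt_eqF.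
have : - complex.Im z <= I by rewrite /I -normrN ler_norm.
rewrite /h /D; move: (skew_const R e) (complex.Re z) => K r.
rewrite /D /h in D0 h0 *; nra.
Qed.

Lemma closure_Tplus_numrange_neq k (B : 'M[C]_k) : closure WT <> mx_numrange B.
Proof.
move=> WB; have [U [A [d [Uu BE Ad]]]] := unitary_realpart_diag C k B.
have inW y : vsq R k y = 1 -> closure WT (qform C A y).
  by move=> y1; rewrite WB (mx_numrangeE _ _ _ _ _ Uu BE); exists y.
have [|e e0|M M0 leM] := Im_qform_le_sqrt R k A d Ad.
- by move=> y /inW; exact: Re_Tplus_closure_le.
- by exists (skew_const R e) => y /inW; exact: Tplus_closure_le.
(* [t] is the tangent of the half-angle in the rational parametrization (c, s) of the circle. Here g
   = 1 - c is of order t^2 while the imaginary part s c is of order t; the bound becomes 1 - t^2 <=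
   M t (1 + t^2). Both t and M t being at most 1/2, this would give 3/4 <= 5/8. *)
pose t := (2 + 2 * M)^-1.
have tM : t * (2 + 2 * M) = 1 by rewrite mulVf // gt_eqF //; lra.
have t0 : 0 < t by rewrite invr_gt0; lra.
have t2 : 0 < 1 + t ^+ 2 by rewrite ltr_pwDl // sqr_ge0.
pose c := (1 - t ^+ 2) / (1 + t ^+ 2); pose s := 2 * t / (1 + t ^+ 2).
have cs : c ^+ 2 + s ^+ 2 = 1 by rewrite /c /s; field; rewrite gt_eqF.
have := wave_val_closure R _ (unit_circle_mul_conj _ _ cs).
rewrite WB (mx_numrangeE _ _ _ _ _ Uu BE) wave_val_complex // => -[y y1 yE].
have g0 : 0 <= 2 * t ^+ 2 / (1 + t ^+ 2).
  by rewrite divr_ge0 ?mulr_ge0 ?sqr_ge0 // ltW.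
have := leM y _ y1 g0; rewrite yE /=.
have cE : 1 - c = 2 * t ^+ 2 / (1 + t ^+ 2).
  by rewrite /c; field; rewrite gt_eqF.
rewrite -cE subKr => /(_ erefl); rewrite cE.
have -> : s * c = 2 * t * (1 - t ^+ 2) / (1 + t ^+ 2) / (1 + t ^+ 2).
  by rewrite /s /c; field; rewrite gt_eqF.
rewrite mulrA ler_pM2r ?invr_gt0 // ler_pdivrMr //.
have -> : M * (2 * t ^+ 2) * (1 + t ^+ 2) = 2 * t * (M * t * (1 + t ^+ 2)).
  by ring.
rewrite ler_pM2l ?mulr_gt0 //.
have Mt : M * t <= 1 / 2 by lra.
have th : t <= 1 / 2 by have := mulr_ge0 M0 (ltW t0); lra.
have tt : t ^+ 2 <= 1 / 4 by nra.
have := ler_wpM2r (ltW t2) Mt; lra.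
Qed.

End TplusVersusMatrix.

Theorem theorem4p1 (R : realType) (k : nat) (k_gt0 : (0 < k)%N) :
  ~ exists B : 'M[Cplx R]_k,
      closure (numrange (@ell2 (Cplx R)) (@ell2_dot (Cplx R)) (@Tplus (Cplx R)))
        = mx_numrange B.
Proof. by case=> B; exact: closure_Tplus_numrange_neq. Qed.
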